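(* Let $a$ and $b$ be positive integers. Then there exists a connected graph $G$ such that $rc^\ell(G)=a$ and $src^\ell(G)=b$ if and only if $a=b=1$ or $2\le a\le b$.
   Context: All graphs are finite, simple and undirected. An edge-coloured path is rainbow if all its edges have distinct colours; a geodesic is a shortest path between its endpoints. An (not necessarily proper) edge-colouring of a connected graph is rainbow connected (resp. strongly rainbow connected) if any two vertices are joined by a rainbow path (resp. rainbow geodesic). An $r$-edge-list assignment of $G$ assigns to each edge $e$ a set $L(e)\subset\mathbb N$ with $|L(e)|\ge r$; an $L$-edge-colouring is an edge-colouring $c$ with $c(e)\in L(e)$ for all $e$. $rc^\ell(G)$ (resp. $src^\ell(G)$) is the minimum integer $r$ such that for every $r$-edge-list assignment $L$ of $G$ there exists a rainbow connected (resp. strongly rainbow connected) $L$-edge-colouring of $G$. *)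

(* Defs.v *)
From mathcomp Require Import all_boot.
From mathcomp Require Import classical_sets cardinality.
Set Implicit Arguments.
Unset Strict Implicit.
Unset Printing Implicit Defensive.

Record sgraph := SGraph {
  vertex :> finType;
  adj : rel vertex;
  adj_sym : symmetric adj;
  adj_irrefl : irreflexive adj }.

Arguments adj {s}.

Definition edge_of (G : sgraph) (x y : G) : {set G} := [set x; y]%SET.

Definition edges (G : sgraph) : {set {set G}} :=
  [set edge_of x y | x in G, y in G & adj x y]%SET.

Definition connected_graph (G : sgraph) : Prop :=
  0 < #|G| /\ forall x y : G, connect adj x y.

(** As in [path], the vertex sequence of a path is split into its first vertex
    [x] and the sequence [p] of the others, so its length is [size p]. *)
Definition is_path (G : sgraph) (x y : G) (p : seq G) : bool :=
  [&& path adj x p, uniq (x :: p) & last x p == y].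

Definition is_geodesic (G : sgraph) (x y : G) (p : seq G) : Prop :=
  is_path x y p /\ forall q : seq G, is_path x y q -> size p <= size q.

(** Edge-colourings and list assignments are total functions on [{set G}];
    only their values on [edges G] are ever used. *)
Definition rainbow (G : sgraph) (c : {set G} -> nat) (x : G) (p : seq G) : bool :=
  uniq (pairmap (fun u v => c (edge_of u v)) x p).

Definition rainbow_connected (G : sgraph) (c : {set G} -> nat) : Prop :=
  forall x y : G, exists p : seq G, is_path x y p /\ rainbow c x p.

Definition strongly_rainbow_connected (G : sgraph) (c : {set G} -> nat) : Prop :=
  forall x y : G, exists p : seq G, is_geodesic x y p /\ rainbow c x p.

(** Lists may be infinite; [`I_r #<= A] says that [A] has at least [r]
    elements. *)
Definition edge_list_assignment (G : sgraph) (r : nat)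
    (L : {set G} -> set nat) : Prop :=
  forall E : {set G}, E \in edges G -> (`I_r #<= L E)%card.

Definition list_edge_colouring (G : sgraph) (L : {set G} -> set nat)
    (c : {set G} -> nat) : Prop :=
  forall E : {set G}, E \in edges G -> L E (c E).

Definition list_rainbow_connectable (G : sgraph) (r : nat) : Prop :=
  forall L : {set G} -> set nat, edge_list_assignment r L ->
    exists c : {set G} -> nat, list_edge_colouring L c /\ rainbow_connected c.

Definition list_strongly_rainbow_connectable (G : sgraph) (r : nat) : Prop :=
  forall L : {set G} -> set nat, edge_list_assignment r L ->
    exists c : {set G} -> nat,
      list_edge_colouring L c /\ strongly_rainbow_connected c.

Definition is_minimum (P : nat -> Prop) (m : nat) : Prop :=
  P m /\ forall r : nat, P r -> m <= r.

(** [is_rcl G r] and [is_srcl G r] stand for rc^l(G) = r and src^l(G) = r. *)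
Definition is_rcl (G : sgraph) (r : nat) : Prop :=
  is_minimum (list_rainbow_connectable G) r.

Definition is_srcl (G : sgraph) (r : nat) : Prop :=
  is_minimum (list_strongly_rainbow_connectable G) r.

(* Main.v *)
Require Import Defs.
From mathcomp Require Import all_boot.
From mathcomp Require Import boolp classical_sets functions cardinality zify.
Set Implicit Arguments.
Unset Strict Implicit.
Unset Printing Implicit Defensive.

(* For [2 <= a <= b] put [N = b - 1] and [d = b - a], and glue two cliques to the
   ends of a path [u - ... - v] of length [a - 2]: a clique of [d + 1] vertices
   joined to [u] and a huge one, [B], joined to [v]. The diameter is [a], so
   rc^l >= a.
   Geodesics between the two ends are unique, so strong rainbow connection means
   that the [N] "low" edges (bridges and edges from the small clique to [u]) and
   the edges [v w], [w] in [B], form a list-colouring problem of the type of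
   K_{N,|B|}. Disjoint lists below and all their transversals on the edges [v w]
   defeat lists of size [N], while [N + 1 = b] colours suffice greedily.
   With lists of size [a], fix distinct bridge colours [F] ([a - 2] of them) and
   [w0] in [B]. Choose the colour [x0] of [v w0] outside [F], then the colours at
   the small clique and those of [w w0] outside [F] and [x0], and finally the
   colour of [v w] outside [F] and different from that of [w w0]. If the edge
   [v w] clashes with an edge of the small clique, the detour [v w0 w] does not. *)

(** * Selecting colours from lists *)

Lemma card_ge_avoid (r : nat) (A : set nat) (s : seq nat) :
  (`I_r #<= A)%card -> size s < r -> exists2 x, A x & x \notin s.
Proof.
move=> /pcard_leP[f] lt_sr; apply: contrapT => noA.
suff : size [seq f i | i <- iota 0 r] <= size s by rewrite size_map size_iota leqNgt lt_sr.
apply: uniq_leq_size => [|y /mapP[i]].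
  rewrite map_inj_in_uniq ?iota_uniq // => i j.
  rewrite !mem_iota /= => lt_ir lt_jr; apply: (@inj _ _ _ f); exact/mem_set.
rewrite mem_iota /= => lt_ir ->; apply/negPn/negP => nfi; apply: noA.
by exists (f i) => //; apply: (@funS _ _ _ _ f).
Qed.

Lemma inj_card_ge (r : nat) (A : set nat) (f : nat -> nat) :
  (forall i, i < r -> A (f i)) ->
  (forall i j, i < r -> j < r -> f i = f j -> i = j) -> (`I_r #<= A)%card.
Proof.
move=> fA f_inj; have fI : {in `I_r &, injective f}.
  by move=> i j; rewrite !inE /=; apply: f_inj.
apply: card_le_trans (subset_card_le (_ : f @` `I_r `<=` A)%classic).
  by rewrite (card_le_eqr (inj_card_eq fI)).
by move=> _ [i /= lt_ir <-]; apply: fA.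
Qed.

(** Greedy: fewer than [r] values are taken when an element of [s] is served, so its set still
    offers a new one. *)
Lemma distinct_representatives (I : eqType) (M : I -> set nat) (r : nat) (s : seq I) :
  uniq s -> size s <= r -> (forall i, i \in s -> (`I_r #<= M i)%card) ->
  exists f : I -> nat,
    (forall i, i \in s -> M i (f i)) /\ {in s &, injective f}.
Proof.
elim: s => [|i s IHs] /=; first by exists (fun=> 0).
move=> /andP[nis us] lt_sr Mr.
have [|f [fM f_inj]] := IHs us (ltnW lt_sr).
  by move=> j js; apply: Mr; rewrite inE js orbT.
have [|x Mx xf] := @card_ge_avoid r (M i) (map f s) (Mr i (mem_head _ _)).
  by rewrite size_map.
exists (fun j => if j == i then x else f j); split.
  by move=> j; rewrite inE; case: eqVneq => [->|_] //=; apply: fM.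
move=> j k; rewrite !inE.
case: (eqVneq j i) => [->|_]; case: (eqVneq k i) => [->|_] //= js ks.
- by move=> xfk; move: xf; rewrite xfk map_f.
- by move=> xfj; move: xf; rewrite -xfj map_f.
- exact: f_inj.
Qed.

(** Serves to prescribe lists or colours on edges named by an index set. The second clause reduces a
    property of all values of [g] to [F] and [dflt]. *)
Lemma extend_along_injection (I : finType) (E : eqType) (T : Type) (D : {pred I})
    (e : I -> E) (F : I -> T) (dflt : E -> T) :
  {in D &, injective e} ->
  exists g : E -> T, (forall i, i \in D -> g (e i) = F i) /\
    forall x, (exists i, [/\ i \in D, x = e i & g x = F i]) \/ g x = dflt x.
Proof.
move=> e_inj.
exists (fun x => if [pick i in D | e i == x] is Some i then F i else dflt x).
split=> [i iD|x]; case: pickP => [j /andP[jD /eqP ej]|none].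
- by rewrite (e_inj j i).
- by have := none i; rewrite iD eqxx.
- by left; exists j.
- by right.
Qed.

(** * Rainbow paths and list colourings in arbitrary graphs *)

Section Generic.
Variable G : sgraph.
Implicit Types (x y z : G) (p : seq G) (c : {set G} -> nat) (L : {set G} -> set nat).

Lemma edge_ofC x y : edge_of x y = edge_of y x.
Proof. exact: finset.setUC. Qed.

Lemma edge_of_inj x y x' y' : edge_of x y = edge_of x' y' ->
  (x = x' /\ y = y') \/ (x = y' /\ y = x').
Proof.
move=> e; have : (x \in edge_of x' y') && (y \in edge_of x' y').
  by rewrite -e !inE !eqxx orbT.
have : (x' \in edge_of x y) && (y' \in edge_of x y).
  by rewrite e !inE !eqxx orbT.
by rewrite !inE => /andP[/orP[]/eqP ? /orP[]/eqP ?] /andP[/orP[]/eqP ? /orP[]/eqP ?];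
  subst; auto.
Qed.

Lemma edge_of_edges x y : adj x y -> edge_of x y \in edges G.
Proof. by move=> xy; apply/imset2P; exists x y; rewrite ?inE. Qed.

Lemma is_path_rev x y p : is_path x y p -> is_path y x (rev (belast x p)).
Proof.
move=> /and3P[xp up /eqP <-]; apply/and3P; split.
- by rewrite rev_path (eq_path (e' := adj)) // => u v; rewrite adj_sym.
- by rewrite -[_ :: _]rev_rcons -lastI rev_uniq.
- by case: (p) => //= z q; rewrite rev_cons last_rcons.
Qed.

Lemma rainbow_rev c x p : rainbow c (last x p) (rev (belast x p)) = rainbow c x p.
Proof.
rewrite /rainbow; set f := fun u v => c _.
suff -> : pairmap f (last x p) (rev (belast x p)) = rev (pairmap f x p).
  by rewrite rev_uniq.
elim: p x => //= y p IHp x; rewrite !rev_cons -!cats1 pairmap_cat IHp /=.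
congr (_ ++ [:: _]); rewrite /f edge_ofC; congr (c (edge_of x _)).
by case: (p) => //= z q; rewrite rev_cons last_rcons.
Qed.

Lemma rainbow_path_rev c x y p : is_path x y p -> rainbow c x p ->
  exists q, is_path y x q /\ rainbow c y q.
Proof.
move=> pxy rp; exists (rev (belast x p)); split; first exact: is_path_rev.
by case/and3P: pxy => _ _ /eqP <-; rewrite rainbow_rev.
Qed.

Lemma rainbow_geodesic_rev c x y p : is_geodesic x y p -> rainbow c x p ->
  exists q, is_geodesic y x q /\ rainbow c y q.
Proof.
move=> [pxy pmin] rp; exists (rev (belast x p)); split.
  split=> [|q qyx]; first exact: is_path_rev.
  by rewrite size_rev size_belast (leq_trans (pmin _ (is_path_rev qyx))) //
    size_rev size_belast.
by case/and3P: pxy => _ _ /eqP <-; rewrite rainbow_rev.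
Qed.

Lemma geodesic_refl x : is_geodesic x x [::].
Proof. by split=> //; apply/and3P; split. Qed.

Lemma geodesic_adj x y : adj x y -> is_geodesic x y [:: y].
Proof.
move=> xy; have nxy : x != y by apply: contraTneq xy => ->; rewrite adj_irrefl.
split; first by rewrite /is_path /= xy inE nxy eqxx.
by case=> // /and3P[_ _] /= /eqP exy; rewrite exy eqxx in nxy.
Qed.

Lemma strongly_rainbow_connectedW c :
  strongly_rainbow_connected c -> rainbow_connected c.
Proof. by move=> cG x y; have [p [[pxy _] rp]] := cG x y; exists p. Qed.

Lemma list_strongly_rainbow_connectableW r :
  list_strongly_rainbow_connectable G r -> list_rainbow_connectable G r.
Proof.
move=> Gr L Lr; have [c [cL cG]] := Gr L Lr; exists c; split=> //.
exact: strongly_rainbow_connectedW.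
Qed.

Lemma rainbow_connected_connect c x y : rainbow_connected c -> connect adj x y.
Proof.
move=> cG; have [p [/and3P[xp _ /eqP <-] _]] := cG x y.
by apply/connectP; exists p.
Qed.

Lemma path_colours c (P : pred nat) x p :
  (forall E, E \in edges G -> P (c E)) -> path adj x p ->
  all P (pairmap (fun u v => c (edge_of u v)) x p).
Proof.
move=> cP; elim: p x => //= y p IHp x /andP[xy yp].
by rewrite IHp // cP // edge_of_edges.
Qed.

(* Constant lists: [r] colours only make paths of length at most [r] rainbow. *)
Lemma list_rainbow_connectable_short_path r x y :
  list_rainbow_connectable G r -> exists2 p, is_path x y p & size p <= r.
Proof.
move=> /(_ (fun=> `I_r)) [|c [cL cG]]; first by move=> E _; apply: card_lexx.
have [p [pxy rp]] := cG x y; exists p => //.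
have cr : all (fun t => t < r) (pairmap (fun u v => c (edge_of u v)) x p).
  by apply: path_colours => //; case/and3P: pxy.
rewrite -(size_pairmap (fun u v => c (edge_of u v)) x) -(size_iota 0 r).
by apply: uniq_leq_size => // t /(allP cr); rewrite mem_iota.
Qed.

Lemma list_rainbow_connectable1_complete x y :
  list_rainbow_connectable G 1 -> x != y -> adj x y.
Proof.
move=> G1 nxy.
have [[|z [|//]]] := list_rainbow_connectable_short_path x y G1.
  by case/and3P=> _ _ /= /eqP exy; rewrite exy eqxx in nxy.
by case/and3P=> /= /andP[xz _] _ /eqP <-.
Qed.

Lemma edge_list_assignmentW L r s :
  r <= s -> edge_list_assignment s L -> edge_list_assignment r L.
Proof.
by move=> rs Ls E EG; apply: card_le_trans (Ls E EG); rewrite card_le_II.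
Qed.

Lemma list_colouring_exists L : edge_list_assignment 1 L ->
  exists c, list_edge_colouring L c.
Proof.
move=> L1; suff /boolp.choice[c cL] : forall E, exists n, E \in edges G -> L E n.
  by exists c.
move=> E; have [EG|] := boolP (E \in edges G); last by exists 0.
by have [x Lx _] := @card_ge_avoid _ _ [::] (L1 E EG) isT; exists x.
Qed.

Lemma complete_list_strongly_rainbow_connectable1 :
  (forall x y, x != y -> adj x y) -> list_strongly_rainbow_connectable G 1.
Proof.
move=> complG L /list_colouring_exists[c cL]; exists c; split=> // x y.
have [->|nxy] := eqVneq x y; first by exists [::]; split=> //; apply: geodesic_refl.
by exists [:: y]; split=> //; apply/geodesic_adj/complG.
Qed.

End Generic.

(** * Graphs built from a layer function *)

Definition layer_adj (T : finType) (h : T -> nat) : rel T :=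
  fun x y => [&& x != y, h x <= (h y).+1 & h y <= (h x).+1].

Lemma layer_adj_sym (T : finType) (h : T -> nat) : symmetric (layer_adj h).
Proof. by move=> x y; rewrite /layer_adj eq_sym [X in _ && X]andbC. Qed.

Lemma layer_adj_irrefl (T : finType) (h : T -> nat) : irreflexive (layer_adj h).
Proof. by move=> x; rewrite /layer_adj eqxx. Qed.

(** Edges change [h] by at most 1, so [h] bounds distances from below. Each layer is a clique;
    consecutive singleton layers form a path. *)
Definition layered (T : finType) (h : T -> nat) : sgraph :=
  SGraph (@layer_adj_sym T h) (@layer_adj_irrefl T h).

Section Layered.
Variables (T : finType) (h : T -> nat).
Let G : sgraph := layered h.
Implicit Types (x y : G) (p : seq G).

Definition ascending : rel G := fun x y => h y == (h x).+1.

Lemma ascending_adj x y : ascending x y -> adj x y.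
Proof.
rewrite /ascending /= /layer_adj => /eqP hy.
by case: eqVneq hy => [-> /n_Sn//|_ ->] /=; rewrite leqnn andbT !leqW.
Qed.

Lemma layer_last_le x p : path adj x p -> h (last x p) <= h x + size p.
Proof.
elim: p x => [|y p IHp] x /=; first by rewrite addn0.
move=> /andP[/and3P[_ _ hy] /IHp /leq_trans]; apply.
by rewrite addnS -addSn leq_add2r.
Qed.

Lemma ascending_last x p : path ascending x p -> h (last x p) = h x + size p.
Proof.
elim: p x => [|y p IHp] x /=; first by rewrite addn0.
by move=> /andP[/eqP hy /IHp ->]; rewrite hy addnS.
Qed.

Lemma ascending_geodesic x p : path ascending x p -> is_geodesic x (last x p) p.
Proof.
move=> xp; split.
  apply/and3P; split=> //; first exact: (sub_path ascending_adj).
  apply: (@sorted_uniq _ (fun u v : G => h u < h v)).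
  - by move=> u v w; apply: ltn_trans.
  - by move=> u; apply: ltnn.
  - by apply: sub_path xp => u v /eqP ->.
move=> q /and3P[/layer_last_le hq _ /eqP lq].
by move: hq; rewrite lq (ascending_last xp) leq_add2l.
Qed.

(** The length bound leaves no slack: every edge must gain a full level. This recovers the shape of
    geodesics from their length. *)
Lemma short_path_ascending x p :
  path adj x p -> h x + size p <= h (last x p) -> path ascending x p.
Proof.
elim: p x => //= y p IHp x /andP[/and3P[_ hx hy] yp] short.
have := leq_trans short (layer_last_le yp); rewrite addnS -addSn leq_add2r => hxy.
have hyx : h y = (h x).+1 by apply/eqP; rewrite eqn_leq hy hxy.
by rewrite /ascending hyx eqxx IHp // hyx addSn -addnS.
Qed.

(** Vertices of one layer are equal or adjacent, so only pairs on distinct layers need work, in one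
    direction. *)
Lemma layered_pair (P : G -> G -> Prop) :
  (forall x y, P x y -> P y x) -> (forall x y, h x < h y -> P x y) ->
  (forall x, P x x) -> (forall x y, adj x y -> P x y) -> forall x y, P x y.
Proof.
move=> Psym Plt Prefl Padj x y.
have [->//|nxy] := eqVneq x y.
have [/Plt//|/Plt/Psym//|hxy] := ltngtP (h x) (h y).
by apply: Padj; rewrite /= /layer_adj nxy hxy !leqnSn.
Qed.

Lemma layered_rainbow_connected c :
  (forall x y, h x < h y -> exists p, is_path x y p /\ rainbow c x p) ->
  @rainbow_connected G c.
Proof.
move=> clt; apply: layered_pair => // [x y [p [xp rp]]|x|x y xy].
- exact: rainbow_path_rev rp.
- by exists [::]; split=> //; case: (geodesic_refl x).
- by exists [:: y]; split=> //; case: (geodesic_adj xy).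
Qed.

Lemma layered_strongly_rainbow_connected c :
  (forall x y, h x < h y -> exists p, is_geodesic x y p /\ rainbow c x p) ->
  @strongly_rainbow_connected G c.
Proof.
move=> clt; apply: layered_pair => // [x y [p [xp rp]]|x|x y xy].
- exact: rainbow_geodesic_rev rp.
- by exists [::]; split=> //; apply: geodesic_refl.
- by exists [:: y]; split=> //; apply: geodesic_adj.
Qed.

End Layered.

(** * The barbell graph and its ascending paths *)

Section Barbell.
Variables (N d : nat) (B : finType).
Hypothesis lt_dN : d < N.

(* Truncated subtraction puts the vertices [0..d] together in layer [0], while
   [d.+1..N] get the singleton layers [1..N - d]; [B] is the top layer. *)
Definition level (x : 'I_N.+1 + B) : nat :=
  match x with inl i => i - d | inr _ => N.+1 - d end.

Definition barbell : sgraph := layered level.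

Definition low (i : nat) : barbell := inl (inord i).
Definition top (w : B) : barbell := inr w.
(** Index of the next vertex towards [low N]: the maximum sends the whole small clique [0..d] to
    [d.+1], the index of [u]. *)
Definition nx (i : nat) : nat := (maxn i d).+1.

Lemma low_val (i : 'I_N.+1) : inl i = low i.
Proof. by rewrite /low inord_val. Qed.

Lemma low_inj i j : i <= N -> j <= N -> low i = low j -> i = j.
Proof. by move=> iN jN [] /(congr1 val); rewrite /= !inordK. Qed.

Lemma level_low i : i <= N -> level (low i) = i - d.
Proof. by move=> iN; rewrite /= inordK. Qed.

Lemma level_eq_low (x : barbell) s : d < s -> s <= N -> level x = s - d -> x = low s.
Proof.
case: x => [i|w] ds sN /= hs; last by lia.
by rewrite low_val; congr low; lia.
Qed.

Lemma nx_le i : i < N -> nx i <= N.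
Proof. by rewrite /nx; lia. Qed.

Lemma ascending_low_nx i : i < N -> ascending (low i) (low (nx i)).
Proof.
by move=> iN; rewrite /ascending !level_low ?nx_le ?(ltnW iN) // /nx; apply/eqP; lia.
Qed.

Lemma ascending_top w : ascending (low N) (top w).
Proof. by rewrite /ascending level_low //=; apply/eqP; lia. Qed.

Definition ascent (i j : nat) : seq barbell := [seq low t | t <- iota (nx i) (j - maxn i d)].

Lemma ascent_ascending i j : i <= N -> j <= N -> path (@ascending _ level) (low i) (ascent i j).
Proof.
move=> iN jN; rewrite /ascent /nx.
(* The start is any [x] on level [s - d]: for [i < d], the vertex [low i] is not [low s] with
   [s = maxn i d]. *)
suff chain x s l : level x = s - d -> d <= s -> l <= N - s ->
    path (@ascending _ level) x [seq low t | t <- iota s.+1 l].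
  by apply: chain; rewrite ?level_low //; lia.
elim: l x s => //= l IHl x s hx ds lN.
have hs : level (low s.+1) = s.+1 - d by rewrite level_low //; lia.
rewrite /ascending hs hx; apply/andP; split; first by apply/eqP; lia.
by apply: IHl => //; lia.
Qed.

Lemma last_ascent i j : i <= j -> d < j -> last (low i) (ascent i j) = low j.
Proof.
move=> ij dj; rewrite /ascent /nx; have [e0|] := posnP (j - maxn i d).
  by rewrite e0 /=; congr low; lia.
case e : (j - maxn i d) => [//|l] _.
by rewrite -[l.+1]addn1 iotaD map_cat last_cat /=; congr low; lia.
Qed.

Lemma mem_ascent_top i j w : top w \notin low i :: ascent i j.
Proof. by rewrite inE; apply/negP => /mapP[]. Qed.

(** * Rainbow paths under prescribed colours *)

Section Colours.
Variables (c : {set barbell} -> nat) (col : nat -> nat) (ctop : B -> nat).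
Hypothesis c_low : forall i, i < N -> c (edge_of (low i) (low (nx i))) = col i.
Hypothesis c_top : forall w, c (edge_of (low N) (top w)) = ctop w.
(** Edges leaving the small clique may share colours, as no ascending path contains two of them. *)
Hypothesis col_bridge :
  forall t t', t < N -> d < t' < N -> t <> t' -> col t <> col t'.

Let f (u v : barbell) := c (edge_of u v).

Lemma ascent_colours i j : i <= j -> d < j -> j <= N ->
  pairmap f (low i) (ascent i j) =
  if i == j then [::] else [seq col t | t <- i :: iota (nx i) (j - nx i)].
Proof.
move=> ij dj jN; rewrite /ascent; case: eqVneq => [eij|nij].
  by have -> : j - maxn i d = 0 by lia.
have -> : j - maxn i d = (j - nx i).+1 by rewrite /nx; lia.
rewrite /= /f c_low; last by lia.
congr (_ :: _); have : d < nx i by rewrite /nx; lia.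
have : nx i + (j - nx i) <= N by rewrite /nx; lia.
move: (j - nx i) => l; elim: l (nx i) => //= l IHl s sN ds.
rewrite IHl ?(ltnW ds) //; try lia.
have -> : low s.+1 = low (nx s) by congr low; rewrite /nx; lia.
by rewrite /f c_low //; lia.
Qed.

Lemma ascent_colours_uniq i j : i <= j -> d < j -> j <= N ->
  uniq (pairmap f (low i) (ascent i j)).
Proof.
move=> ij dj jN; rewrite ascent_colours //; case: eqVneq => // nij.
rewrite map_inj_in_uniq; last first.
  move=> t t'; rewrite !inE !mem_iota /nx => ht ht' ett'.
  have [//|/eqP ntt'] := eqVneq t t'.
  (* At most one edge of the path leaves the small clique, so one of two distinct indices belongs to
     a bridge. *)
  have [dt|dt] := ltnP d t.
    by case: (@col_bridge t' t) => //; lia.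
  by case: (@col_bridge t t') => //; lia.
by rewrite /= iota_uniq mem_iota andbT /nx; lia.
Qed.

Lemma ascent_colours_in i x : i <= N -> x \in pairmap f (low i) (ascent i N) ->
  exists2 t, t < N /\ (t = i \/ d < t) & x = col t.
Proof.
move=> iN; rewrite ascent_colours //; case: eqVneq => // niN /mapP[t].
rewrite inE mem_iota /nx => /orP[/eqP->|ht] ->; [exists i|exists t] => //; lia.
Qed.

Lemma low_low_rainbow i j : i <= N -> j <= N -> i - d < j - d ->
  exists p, is_geodesic (low i) (low j) p /\ rainbow c (low i) p.
Proof.
move=> iN jN hij; exists (ascent i j); split; last by apply: ascent_colours_uniq; lia.
rewrite -[low j](@last_ascent i) //; try lia.
exact/ascending_geodesic/ascent_ascending.
Qed.

Lemma low_top_geodesic i w : i <= N ->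
  is_geodesic (low i) (top w) (rcons (ascent i N) (top w)).
Proof.
move=> iN; rewrite -[X in is_geodesic _ X](last_rcons (low i) (ascent i N) (top w)).
apply: ascending_geodesic; rewrite rcons_path ascent_ascending //=.
by rewrite last_ascent ?ascending_top.
Qed.

Lemma low_top_colours i w : i <= N ->
  pairmap f (low i) (rcons (ascent i N) (top w)) =
  rcons (pairmap f (low i) (ascent i N)) (ctop w).
Proof.
by move=> iN; rewrite -!cats1 pairmap_cat /= last_ascent // -c_top.
Qed.

Lemma low_top_rainbow i w : i <= N ->
  (forall t, t < N -> t = i \/ d < t -> col t <> ctop w) ->
  exists p, is_geodesic (low i) (top w) p /\ rainbow c (low i) p.
Proof.
move=> iN colw; exists (rcons (ascent i N) (top w)); split; first exact: low_top_geodesic.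
rewrite /rainbow low_top_colours // rcons_uniq ascent_colours_uniq // andbT.
by apply/negP => /(ascent_colours_in iN)[t [tN ht]] /esym/colw; apply.
Qed.

Lemma level_lt_ind (P : barbell -> barbell -> Prop) :
  (forall i j, i <= N -> j <= N -> i - d < j - d -> P (low i) (low j)) ->
  (forall i w, i <= N -> P (low i) (top w)) ->
  forall x y, level x < level y -> P x y.
Proof.
move=> Plow Ptop [i|w] [j|w'] /= hxy.
- by rewrite (low_val i) (low_val j); apply: Plow => //; rewrite -ltnS ltn_ord.
- by rewrite (low_val i); apply: Ptop; rewrite -ltnS ltn_ord.
- by have := ltn_ord j; lia.
- by rewrite ltnn in hxy.
Qed.

Lemma barbell_strongly_rainbow_connected :
  (forall t w, t < N -> col t <> ctop w) -> strongly_rainbow_connected c.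
Proof.
move=> colw; apply: layered_strongly_rainbow_connected; apply: level_lt_ind.
  exact: low_low_rainbow.
by move=> i w iN; apply: low_top_rainbow => // t tN _; apply: colw.
Qed.

(* When [col i = ctop w], the detour through [w0] replaces the last colour
   [ctop w] by [ctop w0] and [cin w]. *)
Lemma barbell_rainbow_connected (w0 : B) (cin : B -> nat) :
  (forall w, w != w0 -> c (edge_of (top w) (top w0)) = cin w) ->
  (forall t w, d < t < N -> col t <> ctop w) ->
  (forall t, t <= d -> col t <> ctop w0) ->
  (forall t w, d < t < N -> col t <> cin w) ->
  (forall w, w != w0 -> cin w <> ctop w0 /\ cin w <> ctop w) ->
  rainbow_connected c.
Proof.
move=> c_in col_top col_w0 col_in cin_w.
apply: layered_rainbow_connected; apply: level_lt_ind => [i j iN jN hij|i w iN].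
  by have [p [[]]] := low_low_rainbow iN jN hij; exists p.
(* Bridge colours never equal top colours, so the direct path fails only if its first edge leaves
   the small clique with colour [ctop w]. *)
have [[id eiw]|ndir] := pselect (i <= d /\ col i = ctop w); last first.
  have [|p [[]]] := @low_top_rainbow i w iN; last by exists p.
  move=> t tN; have [dt _|td [eti|//]] := ltnP d t; first by apply: col_top; rewrite dt.
  by move=> eiw; apply: ndir; rewrite -eti.
have nw : w != w0 by apply: contra_notN (col_w0 i id) => /eqP <-.
have [cw0 cw] := cin_w w nw.
exists (rcons (rcons (ascent i N) (top w0)) (top w)); split.
  have [/and3P[pw0 uw0 _] _] := low_top_geodesic w0 iN.
  apply/and3P; split; last by rewrite last_rcons.
    rewrite rcons_path pw0 last_rcons /= /layer_adj /= leqnSn !andbT.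
    by apply: contra nw => /eqP[->].
  rewrite -rcons_cons rcons_uniq uw0 andbT -rcons_cons mem_rcons inE negb_or.
  rewrite mem_ascent_top andbT; by apply: contra nw => /eqP[->].
rewrite /rainbow -(cats1 (rcons _ _)) pairmap_cat low_top_colours // last_rcons /=.
rewrite edge_ofC c_in // cats1 rcons_uniq mem_rcons inE negb_or rcons_uniq.
rewrite ascent_colours_uniq // andbT.
(* It remains that [cin w] differs from [ctop w0] and that neither occurs on the ascent, whose first
   colour [col i] equals [ctop w]. *)
apply/andP; split; first (apply/andP; split; first exact/eqP).
  apply/negP => /(ascent_colours_in iN)[t [tN [->|dt]]].
    by rewrite eiw.
  by move/esym; apply: col_in; rewrite dt.
apply/negP => /(ascent_colours_in iN)[t [tN [->|dt]]] /esym.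
  exact: col_w0.
by apply: col_top; rewrite dt.
Qed.

End Colours.

(** * Colourings with prescribed colours on marked edges *)

Definition up_neighbour (x : barbell) : barbell :=
  match x with inl i => low (nx i) | inr _ => low N end.

(** [up_neighbour] is the parent map of a spanning tree rooted at [low N]. Colours get prescribed on
    the tree edges and on the edges from [w0] to the rest of the top clique. *)
Definition marked_edge (w0 : B) (z : barbell + B) : {set barbell} :=
  match z with inl x => edge_of x (up_neighbour x) | inr w => edge_of (top w) (top w0) end.

(** The root [low N] has no parent, and [w = w0] would not give an edge. *)
Definition marked (w0 : B) : {pred barbell + B} :=
  fun z => match z with inl x => x != low N | inr w => w != w0 end.

Lemma marked_low w0 i : i < N -> (inl (low i) : barbell + B) \in marked w0.
Proof.
move=> iN; apply/negP => /eqP /(low_inj (ltnW iN) (leqnn N)) eiN.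
by rewrite eiN ltnn in iN.
Qed.

Lemma neq_lowN_lt (i : 'I_N.+1) : (inl i : barbell) != low N -> i < N.
Proof.
rewrite low_val => niN; rewrite ltn_neqAle -ltnS ltn_ord andbT.
by apply: contra niN => /eqP ->.
Qed.

Lemma marked_edge_edges w0 z : z \in marked w0 -> marked_edge w0 z \in edges barbell.
Proof.
case: z => [[i|w]|w] hz; apply: edge_of_edges.
- by rewrite /up_neighbour (low_val i); apply/ascending_adj/ascending_low_nx/neq_lowN_lt.
- by rewrite adj_sym; apply/ascending_adj/ascending_top.
- rewrite /= /layer_adj /= leqnSn !andbT; by apply: contra hz => /eqP[->].
Qed.

(** Two low vertices cannot be each other's parents, since [nx] strictly increases the index. *)
Lemma marked_edge_inj w0 : {in marked w0 &, injective (marked_edge w0)}.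
Proof.
move=> [[i|w]|w] [[j|w']|w'] hz hz' /edge_of_inj [] [] //=.
- by move=> ->.
- move: hz hz' => /neq_lowN_lt iN /neq_lowN_lt jN; rewrite (low_val i) (low_val j) => eij eji.
  have := low_inj (ltnW iN) (nx_le jN) eij; have := low_inj (nx_le iN) (ltnW jN) eji.
  by rewrite /nx; lia.
- by move=> [->].
- by move=> [->].
- by move=> [ew]; move: (hz : w != w0); rewrite ew eqxx.
Qed.

(** Unmarked edges get arbitrary colours from their lists; they only serve as paths of length 1. *)
Lemma barbell_list_colouring (L : {set barbell} -> set nat) (w0 : B)
    (col : nat -> nat) (ctop cin : B -> nat) :
  edge_list_assignment 1 L ->
  (forall i, i < N -> L (edge_of (low i) (low (nx i))) (col i)) ->
  (forall w, L (edge_of (low N) (top w)) (ctop w)) ->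
  (forall w, w != w0 -> L (edge_of (top w) (top w0)) (cin w)) ->
  exists c, [/\ list_edge_colouring L c,
    forall i, i < N -> c (edge_of (low i) (low (nx i))) = col i,
    forall w, c (edge_of (low N) (top w)) = ctop w &
    forall w, w != w0 -> c (edge_of (top w) (top w0)) = cin w].
Proof.
move=> /list_colouring_exists[c0 c0L] Llow Ltop Lin.
pose F (z : barbell + B) := match z with
  | inl (inl i) => col i | inl (inr w) => ctop w | inr w => cin w end.
have [c [cF cd]] := extend_along_injection F c0 (@marked_edge_inj w0).
exists c; split.
- move=> E EG; have [[z [hz -> ->]]|->] := cd E; last exact: c0L.
  case: z hz => [[i|w]|w] hz /=.
  + by rewrite low_val; apply/Llow/neq_lowN_lt.
  + by rewrite edge_ofC; apply: Ltop.
  + exact: Lin.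
- move=> i iN; have /= := cF _ (marked_low w0 iN).
  by rewrite inordK // ltnS ltnW.
- by move=> w; rewrite edge_ofC; apply: (cF (inl (top w))).
- by move=> w nw; apply: (cF (inr w)).
Qed.

(** * Upper bounds on the list sizes *)

Lemma low_edge i : i < N -> edge_of (low i) (low (nx i)) \in edges barbell.
Proof. by move=> iN; apply/edge_of_edges/ascending_adj/ascending_low_nx. Qed.

Lemma top_edge w : edge_of (low N) (top w) \in edges barbell.
Proof. exact/edge_of_edges/ascending_adj/ascending_top. Qed.

(** The low edges get distinct colours. An ascending path has at most one top edge, which must avoid
    at most [N] colours. *)
Lemma barbell_strongly_connectable (w0 : B) : list_strongly_rainbow_connectable barbell N.+1.
Proof.
move=> L LN; have L1 := edge_list_assignmentW (isT : 1 <= N.+1) LN.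
have [||i|col [colL col_inj]] := @distinct_representatives _
  (fun i => L (edge_of (low i) (low (nx i)))) N.+1 (iota 0 N).
- exact: iota_uniq.
- by rewrite size_iota.
- by rewrite mem_iota => iN; apply/LN/low_edge.
have /boolp.choice[ctop ctopP] w : exists x,
    L (edge_of (low N) (top w)) x /\ x \notin map col (iota 0 N).
  have [|x Lx nx] := card_ge_avoid (s := map col (iota 0 N)) (LN _ (top_edge w)).
    by rewrite size_map size_iota.
  by exists x.
have [c1 c1L] := list_colouring_exists L1.
have [|||c [cL c_low c_top _]] := @barbell_list_colouring L w0 col ctop
    (fun w => c1 (edge_of (top w) (top w0))) L1.
- by move=> i iN; apply: colL; rewrite mem_iota.
- by move=> w; case: (ctopP w).
- move=> w nw; apply: c1L; exact: (@marked_edge_edges w0 (inr w)).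
exists c; split=> //; apply: (barbell_strongly_rainbow_connected c_low c_top).
- move=> t t' tN /andP[_ t'N] ntt' ett'; apply: ntt'.
  by apply: col_inj; rewrite ?mem_iota.
- move=> t w tN etw; case: (ctopP w) => _ /mapP; apply.
  by exists t; rewrite ?mem_iota.
Qed.

Lemma barbell_connectable (w0 : B) : list_rainbow_connectable barbell (N.+1 - d).
Proof.
move=> L La; have L1 : edge_list_assignment 1 L by apply: edge_list_assignmentW La; lia.
have [||i|br [brL br_inj]] := @distinct_representatives _
  (fun i => L (edge_of (low i) (low (nx i)))) (N.+1 - d) (iota d.+1 (N - d.+1)).
- exact: iota_uniq.
- by rewrite size_iota; lia.
- by rewrite mem_iota => iN; apply/La/low_edge; lia.
set F := map br (iota d.+1 (N - d.+1)).
(* [F] has [a - 2] colours, so a list of size [a = N.+1 - d] can avoid [F] and one more colour. *)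
have szF : (size F).+2 = N.+1 - d by rewrite size_map size_iota; lia.
have brF t : d < t < N -> br t \in F.
  by move=> tN; apply: map_f; rewrite mem_iota; lia.
have avoid E x : E \in edges barbell -> exists2 y, L E y & y \notin x :: F.
  by move=> EG; apply: card_ge_avoid (La E EG) _; rewrite -szF.
(* The extra colour [0] is a dummy: only [F] has to be avoided here. *)
have [x0 Lx0 nx0] := avoid _ 0 (top_edge w0).
have /boolp.choice[lo loP] i : exists y, i < N ->
    L (edge_of (low i) (low (nx i))) y /\ y \notin x0 :: F.
  have [iN|] := ltnP i N; last by exists 0.
  by have [y Ly ny] := avoid _ x0 (low_edge iN); exists y.
have /boolp.choice[cin cinP] w : exists y,
    (w != w0 -> L (edge_of (top w) (top w0)) y) /\ y \notin x0 :: F.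
  have [->|nw] := eqVneq w w0.
    by have [y _ ny] := avoid _ x0 (top_edge w0); exists y.
  have [y Ly ny] := avoid _ x0 (@marked_edge_edges w0 (inr w) nw).
  by exists y.
(* At [w0] the colour is already fixed as [x0]; elsewhere the spare choice separates [ctop w] from
   [cin w]. *)
have /boolp.choice[ctop ctopP] w : exists y,
    [/\ L (edge_of (low N) (top w)) y, y \notin F, w = w0 -> y = x0 &
        w != w0 -> y <> cin w].
  have [->|nw] := eqVneq w w0.
    by exists x0; split=> //; move: nx0; rewrite inE negb_or => /andP[].
  have [y Ly] := avoid _ (cin w) (top_edge w).
  by rewrite inE negb_or => /andP[/eqP ny nF]; exists y; split=> // /eqP; rewrite (negPf nw).
pose col t := if d < t then br t else lo t.
have [|||c [cL c_low c_top c_in]] := @barbell_list_colouring L w0 col ctop cin L1.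
- move=> i iN; rewrite /col; case: ltnP => di; last by case: (loP i iN).
  by apply: brL; rewrite mem_iota; lia.
- by move=> w; case: (ctopP w).
- by move=> w; case: (cinP w).
have colF t : d < t < N -> col t \in F.
  by move=> tN; rewrite /col; case/andP: (tN) => -> _; apply: brF.
have ctop0 : ctop w0 = x0 by case: (ctopP w0) => _ _ ->.
exists c; split=> //; apply: (barbell_rainbow_connected c_low c_top _ c_in).
- move=> t t' tN t'N ntt'; have [dt|td] := ltnP d t.
    rewrite /col dt; case/andP: (t'N) => -> _ /br_inj; rewrite !mem_iota => ett'.
    by apply: ntt'; apply: ett'; lia.
  move=> ett'; have := colF t' t'N; rewrite -ett' /col ltnNge td /=.
  by case: (loP t tN) => _; rewrite inE negb_or => /andP[_ /negPf ->].
- by move=> t w /colF tF etw; case: (ctopP w) => _; rewrite -etw tF.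
- move=> t td; rewrite ctop0 /col ltnNge td /=.
  by case: (loP t (leq_ltn_trans td lt_dN)) => _; rewrite inE negb_or => /andP[/eqP].
- move=> t w /colF tF etw; case: (cinP w) => _.
  by rewrite -etw inE tF orbT.
- move=> w nw; rewrite ctop0; split.
    by case: (cinP w) => _; rewrite inE negb_or => /andP[/eqP].
  by case: (ctopP w) => _ _ _ /(_ nw) nc e; apply: nc.
Qed.

(** * Lower bounds on the list sizes *)

Lemma barbell_connectable_ge (w0 : B) r :
  list_rainbow_connectable barbell r -> N.+1 - d <= r.
Proof.
move=> /(@list_rainbow_connectable_short_path _ r (low 0) (top w0))[p].
case/and3P=> /layer_last_le hp _ /eqP lp; move: hp.
by rewrite lp level_low //= sub0n add0n => /leq_trans; apply.
Qed.

(** Comparison with the ascent through [low N] forces a geodesic to ascend. The layers strictly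
    between bottom and top are singletons, which fixes its second and its penultimate vertex. *)
Lemma low_top_geodesic_shape i w p : i < N -> is_geodesic (low i) (top w) p ->
  exists2 q, p = low (nx i) :: rcons q (top w) & last (low (nx i)) q = low N.
Proof.
move=> iN [/and3P[pp _ /eqP lp] pmin].
have [q0 _] := low_top_geodesic w (ltnW iN).
have asc : path (@ascending _ level) (low i) p.
  apply: short_path_ascending => //; rewrite lp.
  have /ascending_last := ascent_ascending (ltnW iN) (leqnn N).
  rewrite last_ascent ?(ltnW iN) // !level_low ?(ltnW iN) // => eN.
  have := pmin _ q0; rewrite size_rcons /=.
  move: eN; set s1 := size _; set s2 := size _; lia.
case: p => [|y p] in pp lp pmin asc * => //.
have /andP[hy yp] : ascending (low i) y && path (@ascending _ level) y p := asc.
have {hy} ey : y = low (nx i).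
  apply: level_eq_low; rewrite ?nx_le //; first by rewrite /nx; lia.
  by rewrite (eqP hy) level_low ?(ltnW iN) // /nx; lia.
case/lastP: p => [|q z] in pp lp pmin asc yp *.
  by move: lp; rewrite /= ey.
move: lp yp; rewrite /= last_rcons rcons_path => -> /andP[_ /eqP hz].
exists q; rewrite -ey //; apply: level_eq_low => //.
by move: hz => /=; lia.
Qed.

End Barbell.

(* Disjoint lists on the [N] lower edges, and all their transversals on the top
   edges: some top edge only offers colours already used below. *)
Lemma barbell_strongly_connectable_ge (N d r : nat) : d < N ->
  list_strongly_rainbow_connectable (barbell N d {ffun 'I_N -> 'I_N}) r -> N < r.
Proof.
pose B := {ffun 'I_N -> 'I_N}; move=> dN Gr; rewrite ltnNge; apply/negP => rN.
have N0 : 0 < N by apply: leq_ltn_trans dN.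
pose w0 : B := [ffun i => i].
(* The low edge at [low i] gets the block of numbers with quotient [i] by [N]; the top edge at [g]
   gets the transversal with offset [g i] in block [i]. *)
pose F (z : barbell N d B + B) : set nat := match z with
  | inl (inl i) => [set n | n %/ N = i]%classic
  | inl (inr g) => [set n | exists i : 'I_N, n = i * N + g i]%classic
  | inr _ => setT end.
have [L [LF Ld]] := extend_along_injection F (fun=> setT) (marked_edge_inj dN (w0 := w0)).
have [|c [cL cG]] := Gr L.
  apply: edge_list_assignmentW rN _ => E _.
  have [[z [_ _ ->]]|->] := Ld E; last exact: card_leT.
  case: z => [[i|g]|w] /=; last exact: card_leT.
    apply: (@inj_card_ge _ _ (fun n => i * N + n)) => [n nN|n m _ _ /addnI //] /=.
    by rewrite divnMDl // divn_small ?addn0.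
  (* [g] extended by 0 to all naturals, to enumerate the transversal. *)
  pose gn n : nat := oapp (fun i => val (g i)) 0 (insub n).
  have gnN n : gn n < N by rewrite /gn; case: insub => //= i; apply: ltn_ord.
  apply: (@inj_card_ge _ _ (fun n => n * N + gn n)) => [n nN|n m _ _] /=.
    by exists (Ordinal nN); rewrite /gn insubT.
  move=> /(congr1 (fun t => t %/ N)).
  by rewrite !divnMDl // !(divn_small (gnN _)) !addn0.
have lowc (i : 'I_N) : c (edge_of (low N d B i) (low N d B (nx d i))) %/ N = i.
  have iN := ltn_ord i.
  have := cL _ (low_edge B dN iN); have /= := LF _ (marked_low d w0 iN).
  by rewrite inordK ?ltnS ?(ltnW iN) // => ->.
(* [g] records the offsets of the colours used on the low edges, so the list of its top edge
   consists of these very colours. *)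
pose g : B := [ffun i : 'I_N =>
  Ordinal (ltn_pmod (c (edge_of (low N d B i) (low N d B (nx d i)))) N0)].
have : L (edge_of (low N d B N) (top N d g)) (c (edge_of (low N d B N) (top N d g))).
  exact/cL/top_edge.
rewrite {1}edge_ofC (LF (inl (top N d g))) //= => -[i].
rewrite ffunE /= -{1}(lowc i) -divn_eq => cgi.
(* The first and last edges of this geodesic have the same colour. *)
have [p [pgeo]] := cG (low N d B i) (top N d g).
have [q -> lq] := low_top_geodesic_shape dN (ltn_ord i) pgeo.
by rewrite /rainbow /= -cats1 pairmap_cat /= lq mem_cat !inE cgi eqxx orbT.
Qed.

Lemma barbell_is_rcl_srcl (N d : nat) : d < N ->
  exists G : sgraph, [/\ connected_graph G, is_rcl G (N.+1 - d) & is_srcl G N.+1].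
Proof.
move=> dN; pose w0 : {ffun 'I_N -> 'I_N} := [ffun i => i].
exists (barbell N d {ffun 'I_N -> 'I_N}); split.
- split; first by apply/card_gt0P; exists (low N d _ 0).
  (* Connectedness follows from rainbow connection under full lists. *)
  have [_ _|c [_ cG]] := barbell_connectable dN w0 (L := fun=> setT).
    exact: card_leT.
  by move=> x y; apply: rainbow_connected_connect cG.
- by split=> [|r]; [apply: barbell_connectable | apply: barbell_connectable_ge].
- by split=> [|r]; [apply: barbell_strongly_connectable | apply: barbell_strongly_connectable_ge].
Qed.

(** * The single edge, for [a = b = 1] *)

Definition K2 : sgraph := layered (fun _ : bool => 0).

Lemma K2_is_rcl_srcl : [/\ connected_graph K2, is_rcl K2 1 & is_srcl K2 1].
Proof.
have complK2 (x y : K2) : x != y -> adj x y by move=> nxy; rewrite /= /layer_adj nxy.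
have K2_src := complete_list_strongly_rainbow_connectable1 complK2.
have K2_rc := list_strongly_rainbow_connectableW K2_src.
have K2_ge r : list_rainbow_connectable K2 r -> 0 < r.
  move=> /(@list_rainbow_connectable_short_path K2 r true false)[[//|y p] _].
  exact: leq_trans.
split; last by split=> // r /list_strongly_rainbow_connectableW/K2_ge.
- split; first by rewrite card_bool.
  by move=> x y; have [->//|/complK2/connect1] := eqVneq x y.
- by split.
Qed.

Theorem theorem4p3 (a b : nat) (ha : 0 < a) (hb : 0 < b) :
  (exists G : sgraph, [/\ connected_graph G, is_rcl G a & is_srcl G b]) <->
  ((a = 1 /\ b = 1) \/ (2 <= a /\ a <= b)).
Proof.
split=> [[G [_ [Ga a_min] [Gb b_min]]]|[[-> ->]|[a2 ab]]].
- have ab : a <= b by apply/a_min/list_strongly_rainbow_connectableW.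
  (* [a = 1] forces a complete graph, where lists of size 1 suffice for strong connection too. *)
  have [a1|] := leqP a 1; last by right.
  have {a1} a1 : a = 1 by lia.
  left; split=> //; apply/eqP; rewrite eqn_leq hb andbT; apply: b_min.
  apply: complete_list_strongly_rainbow_connectable1 => x y.
  by apply: list_rainbow_connectable1_complete; rewrite -a1.
- by exists K2; apply: K2_is_rcl_srcl.
(* Take [N = b - 1] and [d = b - a]; then [d < N] amounts to [2 <= a]. *)
- have -> : b = b.-1.+1 by lia.
  have -> : a = b.-1.+1 - (b - a) by lia.
  by apply: barbell_is_rcl_srcl; lia.
Qed.
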